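(* If $(\bar x,\bar y,\bar y,\bar u,\bar v)$ is a KKT point of (MDP) (that is, a KKT point whose $z$-component equals its $y$-component), then $(\bar x,\bar y,\bar u,\bar v)$ is an S-stationary point of (MPCC).
   Context: Data: $F:\mathbb{R}^{n+m}\to\mathbb{R}$ is continuously differentiable; $f:\mathbb{R}^{n+m}\to\mathbb{R}$, $g:\mathbb{R}^{n+m}\to\mathbb{R}^p$, $h:\mathbb{R}^{n+m}\to\mathbb{R}^q$ are twice continuously differentiable. $\nabla_x$ and $\nabla_y$ (or $\nabla_z$) denote gradients with respect to the first and second block of variables, and for vector-valued maps the matrix whose columns are the gradients of the components. $L(x,y,u,v)=f(x,y)+u^Tg(x,y)+v^Th(x,y)$; for $\lambda\in\mathbb{R}^m$, $\nabla^2_{yx}L(x,y,u,v)\lambda\in\mathbb{R}^n$ and $\nabla^2_{yy}L(x,y,u,v)\lambda\in\mathbb{R}^m$ denote the gradients of $\lambda^T\nabla_yL(x,y,u,v)$ with respect to $x$ and $y$. There is no upper-level constraint (i.e. $\Omega=\mathbb{R}^{n+m}$). (MDP): minimize $F(x,y)$ over $(x,y,z,u,v)\in\mathbb{R}^n\times\mathbb{R}^m\times\mathbb{R}^m\times\mathbb{R}^p\times\mathbb{R}^q$ s.t. $g(x,y)\le0$, $h(x,y)=0$, $f(x,y)-f(x,z)\le0$, $u^Tg(x,z)+v^Th(x,z)\ge0$, $\nabla_zf(x,z)+\nabla_zg(x,z)u+\nabla_zh(x,z)v=0$, $u\ge0$. KKT point: for a problem $\min\Phi(w)$ s.t. $G(w)\le0$,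 $H(w)=0$ with continuously differentiable data, a feasible point $\bar w$ is a KKT point if there exist multipliers $\lambda\ge0$ and $\mu$ with $\nabla\Phi(\bar w)+\nabla G(\bar w)\lambda+\nabla H(\bar w)\mu=0$ and $\lambda^TG(\bar w)=0$. (MPCC): minimize $F(x,y)$ over $(x,y,u,v)$ s.t. $h(x,y)=0$, $u\ge0$, $g(x,y)\le0$, $u^Tg(x,y)=0$, $\nabla_yf(x,y)+\nabla_yg(x,y)u+\nabla_yh(x,y)v=0$. For a feasible point $(\bar x,\bar y,\bar u,\bar v)$ of (MPCC) let $I_{0+}=\{i:g_i(\bar x,\bar y)=0,\bar u_i>0\}$, $I_{-0}=\{i:g_i(\bar x,\bar y)<0,\bar u_i=0\}$, $I_{00}=\{i:g_i(\bar x,\bar y)=0=\bar u_i\}$. The point is a strongly stationary (S-stationary) point of (MPCC) if there exists $(\lambda^g,\lambda^h,\lambda^u,\lambda^L)\in\mathbb{R}^p\times\mathbb{R}^q\times\mathbb{R}^p\times\mathbb{R}^m$ such that - $\nabla_xF(\bar x,\bar y)+\nabla^2_{yx}L(\bar x,\bar y,\bar u,\bar v)\lambda^L+\nabla_xg(\bar x,\bar y)\lambda^g+\nabla_xh(\bar x,\bar y)\lambda^h=0$, - $\nabla_yF(\bar x,\bar y)+\nabla^2_{yy}L(\bar x,\bar y,\bar u,\bar v)\lambda^L+\nabla_yg(\bar x,\bar y)\lambda^g+\nabla_yh(\bar x,\bar y)\lambda^h=0$, - $\nabla_yg(\bar x,\bar y)^T\lambda^L-\lambda^u=0$, $\nabla_yh(\bar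 x,\bar y)^T\lambda^L=0$, - $\nabla_yL(\bar x,\bar y,\bar u,\bar v)=0$, $g(\bar x,\bar y)\le0$, $\bar u\ge0$, $h(\bar x,\bar y)=0$, - $\lambda^g_i=0$ for $i\in I_{-0}$; $\lambda^u_i=0$ for $i\in I_{0+}$; $\lambda^g_i\ge0$ and $\lambda^u_i\ge0$ for $i\in I_{00}$. *)

(* Defs.v *)
From HB Require Import structures.
From mathcomp Require Import all_boot all_order all_algebra.
From mathcomp Require Import all_classical all_reals all_analysis.
Set Implicit Arguments.
Unset Strict Implicit.
Unset Printing Implicit Defensive.
Import Order.TTheory GRing.Theory Num.Theory.
Import numFieldNormedType.Exports.
Local Open Scope ring_scope.

(* Points of R^N are row vectors, so that the library Jacobian
   'J G w : 'M_(N, k) of G : 'rV_N -> 'rV_k is the matrix whose columns are the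
   gradients of the components of G. Gradients and the multipliers that they
   are combined with are column vectors. R^(n+m) is 'rV_(n + m), and the pair
   (x, y) is row_mx x y. *)

Section Calculus.
Variable R : realType.

Definition as_row N (f : 'rV[R]_N -> R) : 'rV[R]_N -> 'rV[R]_1 :=
  fun w => (f w)%:M.

Definition grad N (f : 'rV[R]_N -> R) (w : 'rV[R]_N) : 'cV[R]_N :=
  'J (as_row f) w.

Definition dot N (a b : 'rV[R]_N) : R := (a *m b^T) 0 0.

Definition C1_map N k (G : 'rV[R]_N -> 'rV[R]_k) : Prop :=
  (forall w, differentiable G w) /\ continuous (jacobian G).

Definition C1 N (f : 'rV[R]_N -> R) : Prop := C1_map (as_row f).

Definition C2 N (f : 'rV[R]_N -> R) : Prop :=
  C1 f /\ C1_map (fun w => (grad f w)^T).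

Definition C2_map N k (G : 'rV[R]_N -> 'rV[R]_k) : Prop :=
  forall j, C2 (fun w => G w 0 j).

End Calculus.

Section PartialGradients.
Variables (R : realType) (n m : nat).

Definition gradx (f : 'rV[R]_(n + m) -> R) (x : 'rV[R]_n) (y : 'rV[R]_m) :
  'cV[R]_n := grad (fun x' => f (row_mx x' y)) x.

Definition grady (f : 'rV[R]_(n + m) -> R) (x : 'rV[R]_n) (y : 'rV[R]_m) :
  'cV[R]_m := grad (fun y' => f (row_mx x y')) y.

Definition jacx k (G : 'rV[R]_(n + m) -> 'rV[R]_k) (x : 'rV[R]_n)
  (y : 'rV[R]_m) : 'M[R]_(n, k) := 'J (fun x' => G (row_mx x' y)) x.

Definition jacy k (G : 'rV[R]_(n + m) -> 'rV[R]_k) (x : 'rV[R]_n)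
  (y : 'rV[R]_m) : 'M[R]_(m, k) := 'J (fun y' => G (row_mx x y')) y.

End PartialGradients.

Section NonlinearPrograms.
Variable R : realType.

(* minimize objective w subject to ineq w <= 0 and eqc w = 0 *)
Record nlp (N k l : nat) := Nlp {
  objective : 'rV[R]_N -> R;
  ineq : 'rV[R]_N -> 'rV[R]_k;
  eqc : 'rV[R]_N -> 'rV[R]_l }.

Definition feasible N k l (P : nlp N k l) (w : 'rV[R]_N) : Prop :=
  (forall i, ineq P w 0 i <= 0) /\ eqc P w = 0.

Definition KKT_point N k l (P : nlp N k l) (w : 'rV[R]_N) : Prop :=
  feasible P w /\
  exists (lambda : 'cV[R]_k) (mu : 'cV[R]_l),
    [/\ forall i, 0 <= lambda i 0,
        grad (objective P) w + 'J (ineq P) w *m lambda + 'J (eqc P) w *m mu = 0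
      & ineq P w *m lambda = 0].

End NonlinearPrograms.

Section Bilevel.
Variables (R : realType) (n m p q : nat).
Variables (F f : 'rV[R]_(n + m) -> R).
Variables (g : 'rV[R]_(n + m) -> 'rV[R]_p) (h : 'rV[R]_(n + m) -> 'rV[R]_q).
Implicit Types (x : 'rV[R]_n) (y z : 'rV[R]_m) (u : 'rV[R]_p) (v : 'rV[R]_q).

Definition mdp_dim := (n + (m + (m + (p + q))))%N.

Definition mdp_point x y z u v : 'rV[R]_mdp_dim :=
  row_mx x (row_mx y (row_mx z (row_mx u v))).

Definition mdp_fun T (k : 'rV[R]_n -> 'rV[R]_m -> 'rV[R]_m -> 'rV[R]_p ->
    'rV[R]_q -> T) (w : 'rV[R]_mdp_dim) : T :=
  let yzuv := rsubmx w in let zuv := rsubmx yzuv in let uv := rsubmx zuv in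
  k (lsubmx w) (lsubmx yzuv) (lsubmx zuv) (lsubmx uv) (rsubmx uv).

Definition mpcc_dim := (n + (m + (p + q)))%N.

Definition mpcc_point x y u v : 'rV[R]_mpcc_dim :=
  row_mx x (row_mx y (row_mx u v)).

Definition mpcc_fun T (k : 'rV[R]_n -> 'rV[R]_m -> 'rV[R]_p -> 'rV[R]_q -> T)
    (w : 'rV[R]_mpcc_dim) : T :=
  let yuv := rsubmx w in let uv := rsubmx yuv in
  k (lsubmx w) (lsubmx yuv) (lsubmx uv) (rsubmx uv).

Definition stationarity x y u v : 'cV[R]_m :=
  grady f x y + jacy g x y *m u^T + jacy h x y *m v^T.

Definition MDP : nlp R mdp_dim (p + (1 + (1 + p))) (q + m) :=
  Nlp (mdp_fun (fun x y z u v => F (row_mx x y)))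
    (mdp_fun (fun x y z u v =>
       row_mx (g (row_mx x y))
      (row_mx (f (row_mx x y) - f (row_mx x z))%:M
      (row_mx (- (dot u (g (row_mx x z)) + dot v (h (row_mx x z))))%:M
              (- u)))))
    (mdp_fun (fun x y z u v =>
       row_mx (h (row_mx x y)) (stationarity x z u v)^T)).

Definition MPCC : nlp R mpcc_dim (p + p) (q + (1 + m)) :=
  Nlp (mpcc_fun (fun x y u v => F (row_mx x y)))
    (mpcc_fun (fun x y u v => row_mx (- u) (g (row_mx x y))))
    (mpcc_fun (fun x y u v =>
       row_mx (h (row_mx x y))
      (row_mx (dot u (g (row_mx x y)))%:M (stationarity x y u v)^T))).

Definition lagrangian u v (w : 'rV[R]_(n + m)) : R :=
  f w + dot u (g w) + dot v (h w).

Definition hess_yx x y u v (lambda : 'cV[R]_m) : 'cV[R]_n :=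
  gradx (fun w => (lambda^T *m
    grady (lagrangian u v) (lsubmx w) (rsubmx w)) 0 0) x y.

Definition hess_yy x y u v (lambda : 'cV[R]_m) : 'cV[R]_m :=
  grady (fun w => (lambda^T *m
    grady (lagrangian u v) (lsubmx w) (rsubmx w)) 0 0) x y.

Definition I_0p x y u : {set 'I_p} :=
  [set i | (g (row_mx x y) 0 i == 0) && (0 < u 0 i)]%SET.

Definition I_m0 x y u : {set 'I_p} :=
  [set i | (g (row_mx x y) 0 i < 0) && (u 0 i == 0)]%SET.

Definition I_00 x y u : {set 'I_p} :=
  [set i | (g (row_mx x y) 0 i == 0) && (u 0 i == 0)]%SET.

Definition S_stationary x y u v : Prop :=
  feasible MPCC (mpcc_point x y u v) /\
  exists (lg : 'cV[R]_p) (lh : 'cV[R]_q) (lu : 'cV[R]_p) (lL : 'cV[R]_m),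
    [/\ gradx F x y + hess_yx x y u v lL + jacx g x y *m lg
          + jacx h x y *m lh = 0,
        grady F x y + hess_yy x y u v lL + jacy g x y *m lg
          + jacy h x y *m lh = 0,
        (jacy g x y)^T *m lL - lu = 0 /\ (jacy h x y)^T *m lL = 0,
        [/\ grady (lagrangian u v) x y = 0,
            forall i, g (row_mx x y) 0 i <= 0,
            forall i, 0 <= u 0 i
          & h (row_mx x y) = 0]
      & [/\ forall i, i \in I_m0 x y u -> lg i 0 = 0,
            forall i, i \in I_0p x y u -> lu i 0 = 0
          & forall i, i \in I_00 x y u -> 0 <= lg i 0 /\ 0 <= lu i 0]].

End Bilevel.

(* Main.v *)
(* Along the diagonal z = y the KKT Lagrangian of (MDP), restricted to
   (x, y) |-> (x, y, y, u, v), loses the value-function term and equals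
   F + g lg + h lh + lL^T grad_y L up to a constant, with lg = alpha - gamma u and
   lh = eta - gamma v, where alpha, gamma, eta, lL are the multipliers of g <= 0,
   of the duality constraint, of h = 0 and of the stationarity equation. Its
   vanishing gradient gives the first two S-stationarity equations at once, and
   the slices in u and in v give the remaining ones; the sign conditions follow
   from complementarity. *)
Require Import Defs.
From mathcomp Require Import all_boot all_order all_algebra.
From mathcomp Require Import all_classical all_reals all_analysis.
From mathcomp Require Import ring.
Set Implicit Arguments.
Unset Strict Implicit.
Unset Printing Implicit Defensive.
Import Order.TTheory GRing.Theory Num.Theory.
Import numFieldNormedType.Exports.
Local Open Scope ring_scope.

(** * Differentiability of row-vector-valued maps on a normed space *)

Section Differentiability.
Variables (R : realType) (V : normedModType R).
Implicit Type t : V.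

(** [G] is the finite sum of its entries times the constant unit rows. This reduces block and
    matrix-valued constructions to scalar functions. *)
Lemma differentiable_row k (G : V -> 'rV[R]_k) t :
  (forall j, differentiable (fun s => G s 0 j) t) -> differentiable G t.
Proof.
move=> dG.
have -> : G = \sum_(j < k) (fun s => G s 0 j *: delta_mx 0 j).
  apply/funext => s; rewrite fct_sumE [LHS]row_sum_delta.
  by apply: eq_bigr.
by apply: differentiable_sum => j; apply: differentiableZl.
Qed.

Lemma differentiable_entry k (G : V -> 'rV[R]_k) j t :
  differentiable G t -> differentiable (fun s => G s 0 j) t.
Proof.
move=> dG; apply: (differentiable_comp (g := fun M : 'rV[R]_k => M 0 j)) => //.
exact: differentiable_coord.
Qed.

Lemma differentiable_fsum k (f : 'I_k -> V -> R) t :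
  (forall i, differentiable (f i) t) ->
  differentiable (fun s => \sum_(i < k) f i s) t.
Proof.
move=> df; rewrite (_ : (fun _ => _) = \sum_(i < k) f i).
  exact: differentiable_sum.
by apply/funext => s; rewrite fct_sumE.
Qed.

Lemma differentiable_row_mx k l (G : V -> 'rV[R]_k) (H : V -> 'rV[R]_l) t :
  differentiable G t -> differentiable H t ->
  differentiable (fun s => row_mx (G s) (H s)) t.
Proof.
move=> dG dH; apply: differentiable_row => j.
case: (splitP j) => i ij.
  have -> : j = lshift l i by apply: val_inj.
  under eq_fun do rewrite row_mxEl.
  exact: differentiable_entry.
have -> : j = rshift k i by apply: val_inj.
under eq_fun do rewrite row_mxEr.
exact: differentiable_entry.
Qed.

Lemma differentiable_lsub k l (G : V -> 'rV[R]_(k + l)) t :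
  differentiable G t -> differentiable (fun s => lsubmx (G s)) t.
Proof.
move=> dG; apply: (differentiable_comp (g := lsubmx)) => //.
exact: differentiable_lsubmx.
Qed.

Lemma differentiable_rsub k l (G : V -> 'rV[R]_(k + l)) t :
  differentiable G t -> differentiable (fun s => rsubmx (G s)) t.
Proof.
move=> dG; apply: (differentiable_comp (g := rsubmx)) => //.
exact: differentiable_rsubmx.
Qed.

Lemma differentiable_as_row (f : V -> R) t :
  differentiable f t -> differentiable (fun s => (f s)%:M : 'rV[R]_1) t.
Proof.
move=> df; apply: differentiable_row => j.
by under eq_fun do rewrite mxE ord1 eqxx mulr1n.
Qed.

Lemma differentiable_mulmxr k l (G : V -> 'rV[R]_k) (A : 'M[R]_(k, l)) t :
  differentiable G t -> differentiable (fun s => G s *m A) t.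
Proof.
move=> dG; apply: differentiable_row => j.
under eq_fun do rewrite mxE.
apply: differentiable_fsum => i; apply: differentiableM => //.
exact: differentiable_entry.
Qed.

Lemma differentiable_dot k (G H : V -> 'rV[R]_k) t :
  differentiable G t -> differentiable H t ->
  differentiable (fun s => dot (G s) (H s)) t.
Proof.
move=> dG dH; rewrite /dot; under eq_fun do rewrite mxE.
apply: differentiable_fsum => i; under eq_fun do rewrite mxE.
by apply: differentiableM; apply: differentiable_entry.
Qed.

End Differentiability.

(** * Calculus rules for Jacobians acting on row vectors *)

Section Jacobian.
Variable R : realType.

(** A matrix is determined by its rows, that is, by its action on the unit row vectors. *)
Lemma jacobianP N k (G : 'rV[R]_N -> 'rV[R]_k) w (A : 'M[R]_(N, k)) :
  differentiable G w -> (forall d, 'd G w d = d *m A) -> 'J G w = A.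
Proof.
move=> dG GA; apply/row_matrixP => i.
by rewrite !rowE -GA /jacobian mul_rV_lin1.
Qed.

Lemma mul_jacobian N k (G : 'rV[R]_N -> 'rV[R]_k) w d :
  differentiable G w -> d *m 'J G w = 'd G w d.
Proof. by move=> dG; rewrite /jacobian mul_rV_lin1. Qed.

(** Directions are rows multiplied on the left of the Jacobian, so the factor of the inner map comes
    first in the chain rule. *)
Lemma jacobian_comp N k l (G : 'rV[R]_k -> 'rV[R]_l) (P : 'rV[R]_N -> 'rV[R]_k)
    w :
  differentiable P w -> differentiable G (P w) ->
  'J (fun s => G (P s)) w = 'J P w *m 'J G (P w).
Proof.
move=> dP dG; apply: jacobianP; first exact: differentiable_comp.
move=> d; rewrite mulmxA mul_jacobian // mul_jacobian //.
by rewrite (diff_comp dP dG).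
Qed.

Lemma jacobianD N k (G H : 'rV[R]_N -> 'rV[R]_k) w :
  differentiable G w -> differentiable H w ->
  'J (fun s => G s + H s) w = 'J G w + 'J H w.
Proof.
move=> dG dH; apply: jacobianP; first exact: differentiableD.
move=> d.
rewrite [RHS]mulmxDr.
have -> : 'd (fun s => G s + H s) w d = 'd G w d + 'd H w d.
  exact: (congr1 (@^~ d) (diffD dG dH)).
by congr (_ + _); apply/esym/mul_jacobian.
Qed.

(** A continuous linear map is its own differential and the constant contributes nothing. This later
    gives the Jacobians of the block embeddings and reads off the coefficients of the slices in [u]
    and [v]. *)
Lemma jacobian_affine N k (A : 'M[R]_(N, k)) (b : 'rV[R]_k) w :
  'J (fun s => b + s *m A) w = A.
Proof.
have dA : differentiable (mulmxr A : 'rV[R]_N -> 'rV[R]_k) w.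
  exact: differentiable_mulmxr.
have dlinA : 'd (mulmxr A : 'rV[R]_N -> 'rV[R]_k) w = mulmxr A :> (_ -> _).
  apply: diff_lin => s; apply: differentiable_continuous.
  exact: differentiable_mulmxr.
have dA' := differentiable_cst b w.
apply: jacobianP => [|d]; first exact: (differentiableD dA' dA).
have -> : 'd (fun s => b + s *m A) w d = 'd (cst b) w d + 'd (mulmxr A) w d.
  exact: (congr1 (@^~ d) (diffD dA' dA)).
have cst0 : 'd (cst b) w d = 0 := congr1 (@^~ d) (diff_cst b w).
exact: etrans (congr2 +%R cst0 (congr1 (@^~ d) dlinA)) (add0r _).
Qed.

Lemma jacobian_cst N k (b : 'rV[R]_k) (w : 'rV[R]_N) : 'J (fun=> b) w = 0.
Proof.
rewrite -[RHS](jacobian_affine 0 b w); congr jacobian.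
by apply/funext => s; rewrite mulmx0 addr0.
Qed.

Lemma jacobian_mulmxr N k l (G : 'rV[R]_N -> 'rV[R]_k) (A : 'M[R]_(k, l)) w :
  differentiable G w -> 'J (fun s => G s *m A) w = 'J G w *m A.
Proof.
move=> dG; have dA : differentiable (mulmxr A : 'rV[R]_k -> 'rV[R]_l) (G w).
  exact: differentiable_mulmxr.
apply: etrans (jacobian_comp dG dA) _; congr (_ *m _).
rewrite -[RHS](jacobian_affine A 0 (G w)); congr jacobian.
by apply/funext => s; rewrite add0r.
Qed.

(** Selecting a component is multiplication by a constant column, so the gradient of a component is
    covered by [jacobian_mulmxr]. *)
Lemma as_row_entry N k (G : 'rV[R]_N -> 'rV[R]_k) j :
  as_row (fun w => G w 0 j) = fun w => G w *m delta_mx j 0.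
Proof.
by apply/funext => w; apply/rowP => i; rewrite ord1 -colE !mxE eqxx mulr1n.
Qed.

Lemma jacobianE N k (G : 'rV[R]_N -> 'rV[R]_k) w i j : differentiable G w ->
  'J G w i j = grad (fun s => G s 0 j) w i 0.
Proof.
by move=> dG; rewrite /grad as_row_entry jacobian_mulmxr // -colE [RHS]mxE.
Qed.

Lemma C1_differentiable N (f : 'rV[R]_N -> R) w : C1 f -> differentiable f w.
Proof.
move=> [df _]; have /(differentiable_entry 0) := df w.
by under eq_fun do rewrite mxE eqxx mulr1n.
Qed.

Lemma C2_map_differentiable N k (G : 'rV[R]_N -> 'rV[R]_k) w :
  C2_map G -> differentiable G w.
Proof.
move=> C2G; apply: differentiable_row => j.
by apply: C1_differentiable; have [] := C2G j.
Qed.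

Lemma C2_grad_differentiable N (f : 'rV[R]_N -> R) i w :
  C2 f -> differentiable (fun s => grad f s i 0) w.
Proof.
move=> [_ [df _]]; have /(differentiable_entry i) := df w.
by under eq_fun do rewrite mxE.
Qed.

End Jacobian.

(** * Partial Jacobians as blocks of the full Jacobian *)

Section PartialJacobians.
Variables (R : realType) (n m : nat).
Implicit Types (x : 'rV[R]_n) (y : 'rV[R]_m).

(** Chain rule along the affine embedding [row_mx s y]: its Jacobian [row_mx 1%:M 0] selects the
    upper block. *)
Lemma jacxE k (G : 'rV[R]_(n + m) -> 'rV[R]_k) x y :
  differentiable G (row_mx x y) -> jacx G x y = usubmx ('J G (row_mx x y)).
Proof.
move=> dG; rewrite /jacx (jacobian_comp (P := fun s => row_mx s y)) //; last first.
  exact: differentiable_row_mx.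
rewrite (_ : (fun s => row_mx s y) =
    fun s => row_mx 0 y + s *m row_mx 1%:M 0).
  rewrite jacobian_affine -[in LHS](vsubmxK ('J G _)) mul_row_col.
  by rewrite mul1mx mul0mx addr0.
by apply/funext => s; rewrite mul_mx_row mulmx1 mulmx0 add_row_mx add0r addr0.
Qed.

Lemma jacyE k (G : 'rV[R]_(n + m) -> 'rV[R]_k) x y :
  differentiable G (row_mx x y) -> jacy G x y = dsubmx ('J G (row_mx x y)).
Proof.
move=> dG; rewrite /jacy (jacobian_comp (P := fun s => row_mx x s)) //; last first.
  exact: differentiable_row_mx.
rewrite (_ : (fun s => row_mx x s) =
    fun s => row_mx x 0 + s *m row_mx 0 1%:M).
  rewrite jacobian_affine -[in LHS](vsubmxK ('J G _)) mul_row_col.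
  by rewrite mul1mx mul0mx add0r.
by apply/funext => s; rewrite mul_mx_row mulmx1 mulmx0 add_row_mx add0r addr0.
Qed.

Lemma gradxE (f : 'rV[R]_(n + m) -> R) x y :
  differentiable f (row_mx x y) -> gradx f x y = usubmx (grad f (row_mx x y)).
Proof. by move=> df; apply/jacxE/differentiable_as_row. Qed.

Lemma gradyE (f : 'rV[R]_(n + m) -> R) x y :
  differentiable f (row_mx x y) -> grady f x y = dsubmx (grad f (row_mx x y)).
Proof. by move=> df; apply/jacyE/differentiable_as_row. Qed.

End PartialJacobians.

(** * The stationarity map, its differentiability and the Hessian terms *)

Section Stationarity.
Variables (R : realType) (n m p q : nat).
Variable f : 'rV[R]_(n + m) -> R.
Variables (g : 'rV[R]_(n + m) -> 'rV[R]_p) (h : 'rV[R]_(n + m) -> 'rV[R]_q).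
Hypotheses (f_C2 : C2 f) (g_C2 : C2_map g) (h_C2 : C2_map h).

Let df w : differentiable f w.
Proof. by apply: C1_differentiable; case: f_C2. Qed.

Let dg w : differentiable g w.
Proof. exact: C2_map_differentiable. Qed.

Let dh w : differentiable h w.
Proof. exact: C2_map_differentiable. Qed.

(** The factors are swapped so that a fixed multiplier [a] becomes a constant column on the right,
    the shape that [jacobian_mulmxr] handles. *)
Lemma dot_mulmx k (a b : 'rV[R]_k) : (dot a b)%:M = b *m a^T.
Proof.
by rewrite -[LHS]tr_scalar_mx /dot -mx11_scalar trmx_mul trmxK.
Qed.

Lemma mulmx_trC k (a b : 'rV[R]_k) : a *m b^T = b *m a^T.
Proof. by rewrite [LHS]mx11_scalar -tr_scalar_mx -mx11_scalar trmx_mul trmxK. Qed.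

(** With [u] and [v] fixed the Lagrangian is a linear combination of [f] and the components of [g]
    and [h], and taking the lower block of the Jacobian is linear. *)
Lemma stationarityE x y u v :
  stationarity f g h x y u v = grady (lagrangian f g h u v) x y.
Proof.
have dL w : differentiable (lagrangian f g h u v) w.
  apply: differentiableD; first apply: differentiableD => //.
    exact: differentiable_dot.
  exact: differentiable_dot.
have -> : grady (lagrangian f g h u v) x y =
    dsubmx (grad (lagrangian f g h u v) (row_mx x y)) by apply: gradyE.
rewrite /grad (_ : as_row _ = fun w => as_row f w + g w *m u^T + h w *m v^T).
  have dfr : differentiable (as_row f) (row_mx x y).
    exact: differentiable_as_row.
  have dgr : differentiable (fun w => g w *m u^T) (row_mx x y).
    exact: differentiable_mulmxr.
  have dhr : differentiable (fun w => h w *m v^T) (row_mx x y).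
    exact: differentiable_mulmxr.
  rewrite (jacobianD (differentiableD dfr dgr) dhr) (jacobianD dfr dgr).
  rewrite !jacobian_mulmxr // !linearD /=.
  by rewrite -!mul_dsub_mx -gradyE // -!jacyE.
apply/funext => w; rewrite /as_row /lagrangian.
by rewrite !raddfD /= !dot_mulmx.
Qed.

(** Second-order smoothness enters here: an entry of the partial Jacobian is an entry of a full
    gradient, shifted by [n], evaluated at the pair of [X] and [Z]. The domain [V] is arbitrary so
    that the result serves both the whole (MDP) space and its slices. *)
Lemma differentiable_jacy k (G : 'rV[R]_(n + m) -> 'rV[R]_k)
    (V : normedModType R) (X : V -> 'rV[R]_n) (Z : V -> 'rV[R]_m) i j t :
  C2_map G -> differentiable X t -> differentiable Z t ->
  differentiable (fun s => jacy G (X s) (Z s) i j) t.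
Proof.
move=> C2G dX dZ; have dG w : differentiable G w by exact: C2_map_differentiable.
rewrite (_ : (fun _ => _) = (fun w => grad (fun s => G s 0 j) w (rshift n i) 0)
    \o (fun s => row_mx (X s) (Z s))); last first.
  by apply/funext => s; rewrite jacyE // mxE jacobianE.
apply: differentiable_comp; first exact: differentiable_row_mx.
exact: (C2_grad_differentiable (rshift n i) _ (C2G j)).
Qed.

Lemma differentiable_grady (V : normedModType R) (X : V -> 'rV[R]_n)
    (Z : V -> 'rV[R]_m) i t : differentiable X t -> differentiable Z t ->
  differentiable (fun s => grady f (X s) (Z s) i 0) t.
Proof.
move=> dX dZ.
rewrite (_ : (fun _ => _) = (fun w => grad f w (rshift n i) 0)
    \o (fun s => row_mx (X s) (Z s))); last first.
  by apply/funext => s; rewrite gradyE // mxE.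
apply: differentiable_comp; first exact: differentiable_row_mx.
exact: (C2_grad_differentiable (rshift n i) _ f_C2).
Qed.

Lemma stationarity_entry x y u v j :
  (stationarity f g h x y u v)^T 0 j = grady f x y j 0
    + \sum_(i < p) jacy g x y j i * u 0 i + \sum_(i < q) jacy h x y j i * v 0 i.
Proof.
rewrite [LHS]mxE [LHS]mxE; congr (_ + _).
  rewrite [LHS]mxE; congr (_ + _); rewrite [LHS]mxE.
  by apply: eq_bigr => i _; rewrite [_^T _ _]mxE.
by rewrite [LHS]mxE; apply: eq_bigr => i _; rewrite [_^T _ _]mxE.
Qed.

Lemma differentiable_stationarity (V : normedModType R) (X : V -> 'rV[R]_n)
    (Z : V -> 'rV[R]_m) (U : V -> 'rV[R]_p) (W : V -> 'rV[R]_q) t :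
  differentiable X t -> differentiable Z t ->
  differentiable U t -> differentiable W t ->
  differentiable (fun s => (stationarity f g h (X s) (Z s) (U s) (W s))^T) t.
Proof.
move=> dX dZ dU dW; apply: differentiable_row => j.
under eq_fun do rewrite stationarity_entry.
apply: differentiableD; first apply: differentiableD.
- exact: differentiable_grady.
- apply: differentiable_fsum => i.
  apply: differentiableM; first exact: differentiable_jacy.
  exact: differentiable_entry.
- apply: differentiable_fsum => i.
  apply: differentiableM; first exact: differentiable_jacy.
  exact: differentiable_entry.
Qed.

Let differentiable_stationarity_mul u v (ze : 'cV[R]_m) w :
  differentiable (fun s : 'rV[R]_(n + m) =>
    (stationarity f g h (lsubmx s) (rsubmx s) u v)^T *m ze) w.
Proof.
apply: differentiable_mulmxr; apply: differentiable_stationarity.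
- exact: differentiable_lsub.
- exact: differentiable_rsub.
- exact: differentiable_cst.
- exact: differentiable_cst.
Qed.

(** Transposing a 1 by 1 product puts the function differentiated in [hess_yx] and [hess_yy] into
    the form in which the stationarity constraint enters the KKT Lagrangian. *)
Let mul_grady_lagrangian u v (ze : 'cV[R]_m) :
  as_row (fun s : 'rV[R]_(n + m) => (ze^T *m
    grady (lagrangian f g h u v) (lsubmx s) (rsubmx s)) 0 0) =
  fun s => (stationarity f g h (lsubmx s) (rsubmx s) u v)^T *m ze.
Proof.
apply/funext => s.
by rewrite /as_row -stationarityE -[LHS]tr_scalar_mx -mx11_scalar trmx_mul trmxK.
Qed.

Let differentiable_mul_grady u v (ze : 'cV[R]_m) w :
  differentiable (fun s : 'rV[R]_(n + m) => (ze^T *m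
    grady (lagrangian f g h u v) (lsubmx s) (rsubmx s)) 0 0) w.
Proof.
rewrite (_ : (fun s => _) = fun s =>
  ((stationarity f g h (lsubmx s) (rsubmx s) u v)^T *m ze) 0 0).
  exact: differentiable_entry.
apply/funext => s.
by rewrite -stationarityE -[in RHS](trmxK ze) -trmx_mul [RHS]mxE.
Qed.

(** Both Hessian terms are blocks of one Jacobian, so the two gradient equations of S-stationarity
    can be treated as one equation on pairs. *)
Lemma hess_yxE x y u v ze : hess_yx f g h x y u v ze =
  usubmx ('J (fun s => (stationarity f g h (lsubmx s) (rsubmx s) u v)^T *m ze)
    (row_mx x y)).
Proof. by rewrite -mul_grady_lagrangian; apply: gradxE. Qed.

Lemma hess_yyE x y u v ze : hess_yy f g h x y u v ze =
  dsubmx ('J (fun s => (stationarity f g h (lsubmx s) (rsubmx s) u v)^T *m ze)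
    (row_mx x y)).
Proof. by rewrite -mul_grady_lagrangian; apply: gradyE. Qed.

End Stationarity.

(** * The Lagrangian of a nonlinear program and its slices *)

Section KKT.
Variable R : realType.

Definition kkt_lagrangian N k l (P : nlp R N k l) (lambda : 'cV[R]_k)
    (mu : 'cV[R]_l) (w : 'rV[R]_N) : 'rV[R]_1 :=
  as_row (objective P) w + ineq P w *m lambda + eqc P w *m mu.

(** By linearity the Jacobian of the Lagrangian at [S t] is the left side of the KKT equation; the
    chain rule multiplies this zero by the Jacobian of [S]. *)
Lemma kkt_lagrangian_slice N k l (P : nlp R N k l) lambda mu T
    (S : 'rV[R]_T -> 'rV[R]_N) t :
  differentiable S t -> differentiable (objective P) (S t) ->
  differentiable (ineq P) (S t) -> differentiable (eqc P) (S t) ->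
  grad (objective P) (S t) + 'J (ineq P) (S t) *m lambda
    + 'J (eqc P) (S t) *m mu = 0 ->
  'J (fun s => kkt_lagrangian P lambda mu (S s)) t = 0.
Proof.
move=> dS dO dI dE grad0.
have dO1 : differentiable (as_row (objective P)) (S t).
  exact: differentiable_as_row.
have dI1 := differentiable_mulmxr lambda dI.
have dE1 := differentiable_mulmxr mu dE.
have dOI := differentiableD dO1 dI1.
have dL : differentiable (kkt_lagrangian P lambda mu) (S t).
  exact: (differentiableD dOI dE1).
apply: etrans (jacobian_comp dS dL) _; rewrite -[RHS](mulmx0 _ ('J S t)).
congr (_ *m _); rewrite -[RHS]grad0.
apply: etrans (jacobianD dOI dE1) _; congr (_ + _).
  apply: etrans (jacobianD dO1 dI1) _; congr (_ + _).
  exact: jacobian_mulmxr.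
exact: jacobian_mulmxr.
Qed.

End KKT.

(** * The KKT equations of (MDP) on the diagonal *)

Section MathematicalProgramWithDuality.
Variables (R : realType) (n m p q : nat).
Variables (F f : 'rV[R]_(n + m) -> R).
Variables (g : 'rV[R]_(n + m) -> 'rV[R]_p) (h : 'rV[R]_(n + m) -> 'rV[R]_q).
Hypotheses (F_C1 : C1 F) (f_C2 : C2 f) (g_C2 : C2_map g) (h_C2 : C2_map h).

Lemma MDP_differentiable w :
  [/\ differentiable (objective (MDP F f g h)) w,
      differentiable (ineq (MDP F f g h)) w
    & differentiable (eqc (MDP F f g h)) w].
Proof.
have dF s : differentiable F s by exact: C1_differentiable.
have df s : differentiable f s by apply: C1_differentiable; case: f_C2.
have dg s : differentiable g s by exact: C2_map_differentiable.
have dh s : differentiable h s by exact: C2_map_differentiable.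
pose D := mdp_dim n m p q.
have dx : differentiable (fun s : 'rV[R]_D => lsubmx s) w.
  exact: differentiable_lsub.
have dyzuv : differentiable (fun s : 'rV[R]_D => rsubmx s) w.
  exact: differentiable_rsub.
have dy := differentiable_lsub dyzuv; have dzuv := differentiable_rsub dyzuv.
have dz := differentiable_lsub dzuv; have duv := differentiable_rsub dzuv.
have du := differentiable_lsub duv; have dv := differentiable_rsub duv.
have dxy := differentiable_row_mx dx dy; have dxz := differentiable_row_mx dx dz.
have fxy := differentiable_comp dxy (df _).
have fxz := differentiable_comp dxz (df _).
have gxz := differentiable_comp dxz (dg _).
have hxz := differentiable_comp dxz (dh _).
split.
- exact: (differentiable_comp dxy (dF _)).
- apply: differentiable_row_mx; first exact: (differentiable_comp dxy (dg _)).
  apply: differentiable_row_mx.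
    exact: (differentiable_as_row (differentiableB fxy fxz)).
  apply: differentiable_row_mx; last exact: (differentiableN du).
  apply: differentiable_as_row; apply: differentiableN.
  exact: (differentiableD (differentiable_dot du gxz)
                          (differentiable_dot dv hxz)).
- apply: differentiable_row_mx; first exact: (differentiable_comp dxy (dh _)).
  exact: (differentiable_stationarity f_C2 g_C2 h_C2 dx dz du dv).
Qed.

(** The minus signs on [ga] and [de] come from rewriting the duality constraint and [u >= 0] as
    inequalities of the form [<= 0]. *)
Lemma MDP_lagrangianE al be ga de et ze x y z u v :
  kkt_lagrangian (MDP F f g h)
    (col_mx al (col_mx be%:M (col_mx ga%:M de))) (col_mx et ze)
    (mdp_point x y z u v) =
  as_row F (row_mx x y) + (g (row_mx x y) *m al
    + (be *: (f (row_mx x y) - f (row_mx x z))%:M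
    + (- ga *: (g (row_mx x z) *m u^T + h (row_mx x z) *m v^T) - u *m de)))
    + (h (row_mx x y) *m et + (stationarity f g h x z u v)^T *m ze).
Proof.
rewrite /kkt_lagrangian /as_row /= /mdp_fun /mdp_point.
rewrite !(row_mxKl, row_mxKr) !mul_row_col !mul_mx_scalar.
have scalar_opp (a b : R) : (- (a + b))%:M = - (a%:M + b%:M) :> 'M[R]_1.
  by rewrite raddfN raddfD.
by rewrite mulNmx scalar_opp !dot_mulmx scalerN scaleNr.
Qed.

(** The Lagrangian is restricted to three families through the point: the diagonal one, the one
    moving only [u], and the one moving only [v]. Each restriction has zero Jacobian. *)
Lemma MDP_KKT_equations al be ga de et ze x y u v (w := row_mx x y) :
  let P := MDP F f g h in let W := mdp_point x y y u v in
  grad (objective P) W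
    + 'J (ineq P) W *m col_mx al (col_mx be%:M (col_mx ga%:M de))
    + 'J (eqc P) W *m col_mx et ze = 0 ->
  [/\ grad F w + 'J (fun s =>
            (stationarity f g h (lsubmx s) (rsubmx s) u v)^T *m ze) w
          + 'J g w *m (al - ga *: u^T) + 'J h w *m (et - ga *: v^T) = 0,
      (jacy g x y)^T *m ze = ga *: (g w)^T + de
    & (jacy h x y)^T *m ze = ga *: (h w)^T].
Proof.
move=> P W grad0.
have slice T (S : 'rV[R]_T -> 'rV[R]_(mdp_dim n m p q)) t : S t = W ->
    differentiable S t -> 'J (fun s => kkt_lagrangian P
      (col_mx al (col_mx be%:M (col_mx ga%:M de))) (col_mx et ze) (S s)) t = 0.
  move=> StW dS; have [dO dI dE] := MDP_differentiable (S t).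
  by apply: (kkt_lagrangian_slice dS dO dI dE); rewrite StW.
have dF s : differentiable F s by exact: C1_differentiable.
have dg s : differentiable g s by exact: C2_map_differentiable.
have dh s : differentiable h s by exact: C2_map_differentiable.
split.
(* Moving [y] and [z] together adds the two corresponding blocks of the KKT equation. *)
- pose S s :=
    mdp_point (lsubmx s : 'rV[R]_n) (rsubmx s : 'rV[R]_m) (rsubmx s) u v.
  have Sw : S w = W by rewrite /S row_mxKl row_mxKr.
  have dl : differentiable (fun s : 'rV[R]_(n + m) => lsubmx s) w.
    exact: differentiable_lsub.
  have dr : differentiable (fun s : 'rV[R]_(n + m) => rsubmx s) w.
    exact: differentiable_rsub.
  have du := differentiable_cst u w; have dv := differentiable_cst v w.
  have dS : differentiable S w.
    exact: (differentiable_row_mx dl (differentiable_row_mx dr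
              (differentiable_row_mx dr (differentiable_row_mx du dv)))).
  (* The zero on the right becomes the Jacobian of the slice, which is then computed summand by
     summand. *)
  rewrite -(slice _ S w Sw dS).
  have dstat := differentiable_stationarity f_C2 g_C2 h_C2 dl dr du dv.
  rewrite (_ : (fun s => kkt_lagrangian _ _ _ _) = fun s => as_row F s
      + (stationarity f g h (lsubmx s) (rsubmx s) u v)^T *m ze
      + g s *m (al - ga *: u^T) + h s *m (et - ga *: v^T) + - (u *m de)); last first.
    apply/funext => s; rewrite MDP_lagrangianE hsubmxK subrr raddf0 scaler0 add0r.
    rewrite !mulmxBr -!scalemxAr scaleNr scalerDr.
    (* Naming the products keeps them atomic when the identity is checked entrywise by [ring]. *)
    set a := as_row F s; set b := g s *m al; set c := ga *: (g s *m _).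
    set d := ga *: (h s *m _); set e := u *m de; set k := h s *m et.
    set r := (stationarity _ _ _ _ _ _ _)^T *m ze.
    apply/matrixP => i j; rewrite !mxE; ring.
  have dF1 : differentiable (as_row F) w by exact: differentiable_as_row.
  have dst1 := differentiable_mulmxr ze dstat.
  have dg1 := differentiable_mulmxr (al - ga *: u^T) (dg w).
  have dh1 := differentiable_mulmxr (et - ga *: v^T) (dh w).
  have D1 := differentiableD dF1 dst1; have D2 := differentiableD D1 dg1.
  have D3 := differentiableD D2 dh1.
  apply/esym; apply: etrans (jacobianD D3 (differentiable_cst _ w)) _.
  rewrite -[RHS]addr0; congr (_ + _); last exact: jacobian_cst.
  apply: etrans (jacobianD D2 dh1) _; congr (_ + _); last exact: jacobian_mulmxr.
  apply: etrans (jacobianD D1 dg1) _; congr (_ + _); last exact: jacobian_mulmxr.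
  apply: etrans (jacobianD dF1 dst1) _; congr (_ + _).
- pose S (s : 'rV[R]_p) := mdp_point x y y s v.
  have dx := differentiable_cst x u; have dy := differentiable_cst y u.
  have dv := differentiable_cst v u.
  have dS : differentiable S u.
    apply: (differentiable_row_mx dx (differentiable_row_mx dy
              (differentiable_row_mx dy (differentiable_row_mx _ dv)))).
    exact: ex_diff.
  have := slice _ S u erefl dS.
  (* The Lagrangian is affine in [u], so its zero Jacobian says that the coefficient of [s]
     vanishes. *)
  rewrite (_ : (fun s => kkt_lagrangian _ _ _ _) = fun s =>
      (as_row F w + g w *m al - ga *: (h w *m v^T) + h w *m et
        + (grady f x y + jacy h x y *m v^T)^T *m ze)
      + s *m ((jacy g x y)^T *m ze - ga *: (g w)^T - de)); last first.
    apply/funext => s; rewrite MDP_lagrangianE subrr raddf0 scaler0 add0r.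
    rewrite /stationarity !linearD /= !trmx_mul !trmxK.
    rewrite !mulmxDl !mulmxN -!scalemxAr.
    (* The variable stands transposed in [g w *m s^T]; the swap brings it to the left. *)
    rewrite -/w mulmxA (mulmx_trC (g w)).
    apply/matrixP => i j; rewrite !mxE; ring.
  by rewrite jacobian_affine => /eqP; rewrite subr_eq0 subr_eq addrC => /eqP.
- pose S (s : 'rV[R]_q) := mdp_point x y y u s.
  have dx := differentiable_cst x v; have dy := differentiable_cst y v.
  have du := differentiable_cst u v.
  have dS : differentiable S v.
    apply: (differentiable_row_mx dx (differentiable_row_mx dy
              (differentiable_row_mx dy (differentiable_row_mx du _)))).
    exact: ex_diff.
  have := slice _ S v erefl dS.
  rewrite (_ : (fun s => kkt_lagrangian _ _ _ _) = fun s =>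
      (as_row F w + g w *m al - ga *: (g w *m u^T) - u *m de + h w *m et
        + (grady f x y + jacy g x y *m u^T)^T *m ze)
      + s *m ((jacy h x y)^T *m ze - ga *: (h w)^T)); last first.
    apply/funext => s; rewrite MDP_lagrangianE subrr raddf0 scaler0 add0r.
    rewrite /stationarity !linearD /= !trmx_mul !trmxK.
    rewrite !mulmxDl !mulmxN -!scalemxAr.
    rewrite -/w mulmxA (mulmx_trC (h w)).
    apply/matrixP => i j; rewrite !mxE; ring.
  by rewrite jacobian_affine => /eqP; rewrite subr_eq0 => /eqP.
Qed.

End MathematicalProgramWithDuality.

(** This turns the aggregate conditions, the duality constraint and KKT complementarity, into
    componentwise ones. *)
Lemma sum_nonpos_eq0 (R : realType) (p : nat) (a : 'I_p -> R) :
  (forall i, a i <= 0) -> 0 <= \sum_(i < p) a i -> forall i, a i = 0.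
Proof.
move=> a_le0 sum_ge0 i; apply/eqP; rewrite -oppr_eq0; apply/eqP.
have opp_ge0 j : true -> 0 <= - a j by rewrite oppr_ge0.
apply: (psumr_eq0P opp_ge0) => //; apply/eqP; rewrite sumrN oppr_eq0.
by rewrite eq_le sum_ge0 sumr_le0.
Qed.

(** * From KKT multipliers of (MDP) to S-stationarity multipliers *)

Theorem theorem5p2 (R : realType) (n m p q : nat)
    (F f : 'rV[R]_(n + m) -> R)
    (g : 'rV[R]_(n + m) -> 'rV[R]_p) (h : 'rV[R]_(n + m) -> 'rV[R]_q)
    (F_C1 : C1 F) (f_C2 : C2 f) (g_C2 : C2_map g) (h_C2 : C2_map h)
    (x : 'rV[R]_n) (y : 'rV[R]_m) (u : 'rV[R]_p) (v : 'rV[R]_q) :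
  KKT_point (MDP F f g h) (mdp_point x y y u v) ->
  S_stationary F f g h x y u v.
Proof.
move=> [[ineq_le0 eqc0] [lam [mu [lam_ge0 grad0 compl]]]].
have [al [be [ga [de lamE]]]] : exists al be ga de,
    lam = col_mx al (col_mx be%:M (col_mx ga%:M de)).
  exists (usubmx lam), (usubmx (dsubmx lam) 0 0),
    (usubmx (dsubmx (dsubmx lam)) 0 0), (dsubmx (dsubmx (dsubmx lam))).
  by rewrite -!mx11_scalar !vsubmxK.
have [et [ze muE]] : exists et ze, mu = col_mx et ze.
  by exists (usubmx mu), (dsubmx mu); rewrite vsubmxK.
subst lam mu.
have [E1 E2 E3] := MDP_KKT_equations F_C1 f_C2 g_C2 h_C2 grad0.
clear grad0; set w := row_mx x y in E1 E2 E3 *.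
have al_ge0 i : 0 <= al i 0.
  by have := lam_ge0 (lshift _ i); rewrite col_mxEu.
have de_ge0 i : 0 <= de i 0.
  by have := lam_ge0 (rshift _ (rshift _ (rshift _ i))); rewrite !col_mxEd.
have [h0 stat0] : h w = 0 /\ stationarity f g h x y u v = 0.
  move: eqc0; rewrite /= /mdp_fun /mdp_point !(row_mxKl, row_mxKr) -/w => eqc0.
  split.
    by rewrite -[LHS](row_mxKl _ (stationarity f g h x y u v)^T) eqc0 linear0.
  by rewrite -[LHS]trmxK -[X in X^T](row_mxKr (h w)) eqc0 !linear0.
have dotE : dot u (g w) = \sum_(i < p) u 0 i * g w 0 i.
  by rewrite /dot mxE; apply: eq_bigr => i _; rewrite mxE.
(* On the diagonal the value-function constraint equals zero, and [h w = 0] removes the [v] term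
   from the duality constraint. *)
have ineqE : ineq (MDP F f g h) (mdp_point x y y u v) =
    row_mx (g w) (row_mx 0 (row_mx (- dot u (g w))%:M (- u))).
  rewrite /= /mdp_fun /mdp_point !(row_mxKl, row_mxKr) -/w subrr raddf0 h0.
  by rewrite [dot v 0]/dot trmx0 mulmx0 mxE addr0.
rewrite ineqE in ineq_le0 compl.
have g_le0 i : g w 0 i <= 0.
  by have := ineq_le0 (lshift _ i); rewrite row_mxEl.
have u_ge0 i : 0 <= u 0 i.
  have := ineq_le0 (rshift _ (rshift _ (rshift _ i))).
  by rewrite !row_mxEr mxE oppr_le0.
have dot_ge0 : 0 <= dot u (g w).
  have := ineq_le0 (rshift _ (rshift _ (lshift _ 0))).
  by rewrite !row_mxEr row_mxEl mxE eqxx mulr1n oppr_le0.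
(* Feasibility makes every product nonpositive, while the duality constraint makes their sum
   nonnegative. *)
have ug0 i : u 0 i * g w 0 i = 0.
  by apply: (sum_nonpos_eq0 (a := fun i => u 0 i * g w 0 i)) => [j|];
    rewrite -?dotE // mulr_ge0_le0.
have dot0 : dot u (g w) = 0 by rewrite dotE big1.
(* Since [dot0] kills the duality term, complementarity is a vanishing sum of these nonpositive
   numbers. *)
have compl_i i : g w 0 i * al i 0 - u 0 i * de i 0 = 0.
  apply: (sum_nonpos_eq0 (a := fun i => g w 0 i * al i 0 - u 0 i * de i 0)).
    move=> j.
    by rewrite subr_le0 (le_trans (y := 0)) ?mulr_le0_ge0 ?mulr_ge0.
  move: compl; rewrite dot0 oppr0 raddf0 !mul_row_col !mul0mx !add0r mulNmx.
  move=> /(congr1 (fun M : 'M[R]_1 => M 0 0)); rewrite !mxE -sumrB => ->.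
  exact: lexx.
(* By [compl_i] this nonpositive product equals the nonnegative [u 0 i * de i 0]. *)
have galpha0 i : g w 0 i * al i 0 = 0.
  apply/eqP; rewrite eq_le mulr_le0_ge0 //=.
  by have /eqP := compl_i i; rewrite subr_eq0 => /eqP ->; rewrite mulr_ge0.
have udelta0 i : u 0 i * de i 0 = 0.
  by have := compl_i i; rewrite galpha0 sub0r => /eqP; rewrite oppr_eq0 => /eqP.
split.
  split=> [i|]; last first.
    rewrite /= /mpcc_fun /mpcc_point !(row_mxKl, row_mxKr) -/w.
    by rewrite h0 dot0 stat0 raddf0 trmx0 !row_mx0.
  rewrite /= /mpcc_fun /mpcc_point !(row_mxKl, row_mxKr) -/w.
  case: (splitP i) => j ij.
    have -> : i = lshift p j by apply: val_inj.
    by rewrite row_mxEl mxE oppr_le0.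
  have -> : i = rshift p j by apply: val_inj.
  by rewrite row_mxEr.
have dF := C1_differentiable w F_C1.
have dg : differentiable g w by exact: C2_map_differentiable.
have dh : differentiable h w by exact: C2_map_differentiable.
(* The multiplier of [u] is forced by its defining equation; [E2] rewrites it as
   [ga *: (g w)^T + de], from which its signs are read. *)
exists (al - ga *: u^T), (et - ga *: v^T), ((jacy g x y)^T *m ze), ze.
split.
(* The upper block of [E1] is the equation in [x]; the lower block, used next, is the one in [y]. *)
- rewrite gradxE // hess_yxE // !jacxE // !mul_usub_mx -!linearD /=.
  by rewrite E1 linear0.
- rewrite gradyE // hess_yyE // !jacyE // !mul_dsub_mx -!linearD /=.
  by rewrite E1 linear0.
- by rewrite subrr E3 h0 trmx0 scaler0.
- by split=> //; rewrite -stationarityE.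
- have luE i : ((jacy g x y)^T *m ze) i 0 = ga * g w 0 i + de i 0.
    by rewrite E2 !mxE.
  have lgE i : (al - ga *: u^T) i 0 = al i 0 - ga * u 0 i.
    by rewrite !mxE.
  split=> i; rewrite inE -/w => /andP[].
  (* Here the multiplier of [g] reduces to [al i 0], which vanishes because [g] is strictly
     negative. *)
  + move=> g_lt0 /eqP u0; rewrite lgE u0 mulr0 subr0.
    by have /eqP := galpha0 i; rewrite mulf_eq0 lt_eqF //= => /eqP.
  (* Here the multiplier of [u] reduces to [de i 0], which vanishes because [u] is strictly
     positive. *)
  + move=> /eqP g0 u_gt0; rewrite luE g0 mulr0 add0r.
    by have /eqP := udelta0 i; rewrite mulf_eq0 gt_eqF //= => /eqP.
  (* On the biactive set both [ga] corrections vanish, leaving the nonnegative [al i 0] and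
     [de i 0]. *)
  + by move=> /eqP g0 /eqP u0; rewrite lgE luE g0 u0 !mulr0 subr0 add0r.
Qed.
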